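(* Compatible search (as described in the context) correctly detects cycles and maintains a topological order: for every added arc $(v,w)$ with $v>w$ added to an acyclic graph with topological order $<$, the compatible search returns a non-null arc if and only if adding $(v,w)$ creates a cycle (and in that case there is indeed a cycle), and if it returns null then after the reordering step the new order is a topological order of the graph including $(v,w)$.
   Context: Setting: a directed graph on a fixed vertex set, acyclic before the addition of a new arc $(v,w)$, with a total order $<$ on the vertices that is topological (every arc $(x,y)$ has $x<y$). If $v<w$ nothing is done. If $v>w$, run compatible search, with all comparisons in the order before the addition and using the arcs of the graph other than $(v,w)$: set $F=\{w\}$, $B=\{v\}$, $A_F=\{\text{arcs }(w,x)\}$, $A_B=\{\text{arcs }(y,v)\}$. While there exist $(u,x)\in A_F$ and $(y,z)\in A_B$ with $u<z$: choose any such pair, remove $(u,x)$ from $A_F$ and $(y,z)$ from $A_B$; if $x\in B$ return $(u,x)$; else if $y\in F$ return $(y,z)$; if $x\notin F$, add $x$ to $F$ and add all arcs out of $x$ to $A_F$; if $y\notin B$, add $y$ to $B$ and add all arcs into $y$ to $A_B$. When the loop ends, return null. If null is returned, reorder: let $t=\min(\{v\}\cup\{u:\exists (u,x)\in A_F\})$, $F_<=\{x\in F: x<t\}$, $B_>=\{y\in B: y>t\}$. If $t=v$, move all vertices of $F_<$ to just after $t$; otherwise move all vertices of $F_<$ to just before $t$ and all vertices of $B_>$ to just before all vertices of $F_<$. In either case order the vertices within $F_<$ and within $B_>$ topologically with respect to the subgraphs they induce. Convention: the minimum of an empty set exceeds every value and the maximum of an empty set is below every value.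
   Formalization: The second test is y ∈ F ∪ {x} instead of y ∈ F, so the search returns (y,z) when both chosen arcs meet at a new vertex x = y; as written, with arcs (w,x), (x,v) and order w<x<v, the search returns null although adding (v,w) creates a cycle. *)

(* Defs.v *)
From mathcomp Require Import all_boot.

Set Implicit Arguments.
Unset Strict Implicit.
Unset Printing Implicit Defensive.

(* A directed graph on the finite vertex type T is its set of arcs. *)
Definition arc_rel (T : finType) (E : {set T * T}) : rel T :=
  [rel x y | (x, y) \in E].

Definition has_cycle (T : finType) (E : {set T * T}) : Prop :=
  exists2 c : seq T, c != [::] & cycle (arc_rel E) c.

Definition acyclic (T : finType) (E : {set T * T}) : Prop := ~ has_cycle E.

(* A total order on the vertices is the list of all of them, without
   repetition, in increasing order; "moving" vertices is then an edit of the
   list. *)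
Definition vertex_order (T : finType) (s : seq T) : Prop :=
  uniq s /\ forall x : T, x \in s.

Definition before (T : finType) (s : seq T) (x y : T) : bool :=
  index x s < index y s.

Definition topological (T : finType) (E : {set T * T}) (s : seq T) : Prop :=
  forall x y : T, (x, y) \in E -> before s x y.

Definition topological_order (T : finType) (E : {set T * T}) (s : seq T) :=
  vertex_order s /\ topological E s.

Definition arcs_out (T : finType) (E : {set T * T}) (x : T) : {set T * T} :=
  [set a in E | a.1 == x].

Definition arcs_into (T : finType) (E : {set T * T}) (y : T) : {set T * T} :=
  [set a in E | a.2 == y].

Record state (T : finType) := State {
  fwd : {set T};                (* F *)
  bwd : {set T};                (* B *)
  fwd_arcs : {set T * T};       (* A_F *)
  bwd_arcs : {set T * T}        (* A_B *)
}.

Definition initial (T : finType) (E : {set T * T}) (v w : T) : state T :=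
  State [set w] [set v] (arcs_out E w) (arcs_into E v).

(* The arcs a = (u, x) in A_F and b = (y, z) in A_B satisfy u < z. *)
Definition eligible (T : finType) (s : seq T) (st : state T) (a b : T * T) :=
  [&& a \in fwd_arcs st, b \in bwd_arcs st & before s a.1 b.2].

Definition drop_pair (T : finType) (st : state T) (a b : T * T) : state T :=
  State (fwd st) (bwd st) (fwd_arcs st :\ a) (bwd_arcs st :\ b).

(* The two tests on a chosen pair a = (u, x), b = (y, z).  The vertex x counts
   as forward when y is tested, i.e., the test is y \in F :|: [set x] and not
   just y \in F.  The two differ only if x = y is in neither F nor B; without
   the early return x would then enter both F and B, and the cycle could be
   missed: for the arcs (w, x), (x, v) and the order w < x < v, the pair
   (w, x), (x, v) is traversed, A_F = {(x, v)} and A_B = {(w, x)} remain, and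
   the search ends with null since x < x fails. *)
Definition meets_bwd (T : finType) (st : state T) (a : T * T) : bool :=
  a.2 \in bwd st.

Definition meets_fwd (T : finType) (st : state T) (a b : T * T) : bool :=
  b.1 \in a.2 |: fwd st.

Definition visit_fwd (T : finType) (E : {set T * T}) (x : T) (st : state T) :=
  if x \in fwd st then st
  else State (x |: fwd st) (bwd st)
             (fwd_arcs st :|: arcs_out E x) (bwd_arcs st).

Definition visit_bwd (T : finType) (E : {set T * T}) (y : T) (st : state T) :=
  if y \in bwd st then st
  else State (fwd st) (y |: bwd st)
             (fwd_arcs st) (bwd_arcs st :|: arcs_into E y).

(* One iteration of the loop that does not return. *)
Inductive search_step (T : finType) (E : {set T * T}) (s : seq T)
    (st : state T) : state T -> Prop :=
  | SearchStep a b of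
      eligible s st a b & ~~ meets_bwd st a & ~~ meets_fwd st a b :
      search_step E s st
        (visit_bwd E b.1 (visit_fwd E a.2 (drop_pair st a b))).

(* search E s st r st' : some run of the loop from the state st returns r
   (None is null) and leaves the state st'. *)
Inductive search (T : finType) (E : {set T * T}) (s : seq T) :
    state T -> option (T * T) -> state T -> Prop :=
  | SearchNull st of (forall a b, ~~ eligible s st a b) :
      search E s st None st
  | SearchFwd st a b of eligible s st a b & meets_bwd st a :
      search E s st (Some a) (drop_pair st a b)
  | SearchBwd st a b of
      eligible s st a b & ~~ meets_bwd st a & meets_fwd st a b :
      search E s st (Some b) (drop_pair st a b)
  | SearchNext st st1 r st' of search_step E s st st1 & search E s st1 r st' :
      search E s st r st'.

Definition compatible_search (T : finType) (E : {set T * T}) (s : seq T)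
    (v w : T) (r : option (T * T)) (st : state T) : Prop :=
  search E s (initial E v w) r st.

Definition threshold (T : finType) (s : seq T) (v : T) (st : state T) : T :=
  let D := v |: [set a.1 | a in fwd_arcs st] in
  [arg min_(t < v in D) index t s].

Definition fwd_below (T : finType) (s : seq T) (t : T) (st : state T) :=
  [set x in fwd st | before s x t].

Definition bwd_above (T : finType) (s : seq T) (t : T) (st : state T) :=
  [set y in bwd st | before s t y].

(* l lists A in a topological order of the subgraph induced by A. *)
Definition topological_listing (T : finType) (E : {set T * T}) (A : {set T})
    (l : seq T) : Prop :=
  [/\ uniq l, l =i A
    & forall x y, x \in A -> y \in A -> (x, y) \in E -> before l x y].

Definition move_just_after (T : finType) (l : seq T) (t : T) (s : seq T) :=
  let s0 := [seq x <- s | x \notin l] in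
  take (index t s0).+1 s0 ++ l ++ drop (index t s0).+1 s0.

Definition move_just_before (T : finType) (l : seq T) (t : T) (s : seq T) :=
  let s0 := [seq x <- s | x \notin l] in
  take (index t s0) s0 ++ l ++ drop (index t s0) s0.

(* The final state st of the search admits s' as a result of reordering s.
   When F_< is empty, "just before all of F_<" means just before t. *)
Definition reordering (T : finType) (E : {set T * T}) (s : seq T) (v : T)
    (st : state T) (s' : seq T) : Prop :=
  let t := threshold s v st in
  exists lF lB : seq T,
    [/\ topological_listing E (fwd_below s t st) lF,
        topological_listing E (bwd_above s t st) lB
      & s' = if t == v then move_just_after lF t s
             else move_just_before (lB ++ lF) t s].

(* Main.v *)
(** The search keeps [F] inside the descendants of [w], [B] inside the
    ancestors of [v], and [F] and [B] disjoint; every arc out of [F] is still in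
    [A_F] or leads back into [F], and symmetrically for [B].  A returned arc thus
    closes a path from [w] to [v].  If null is returned, every vertex of [F_<]
    has all its successors in [F], and, when [t < v], every vertex of [B_>] has
    all its predecessors in [B], since [t] is then the source of an arc of [A_F]
    which no arc of [A_B] can be paired with.  Hence moving [F_<] and [B_>] next
    to [t] breaks no arc and puts [v] before [w].  Conversely a graph with a
    topological order is acyclic, so null is never returned on a cycle. *)
Require Import Defs.
From mathcomp Require Import all_boot.

Set Implicit Arguments.
Unset Strict Implicit.
Unset Printing Implicit Defensive.

(** * Orders given by lists, and moving a block within one *)

Section Orders.

Variable T : finType.
Implicit Types (E : {set T * T}) (s l : seq T) (x y t : T).

Lemma before_trans s : transitive (before s).
Proof. by move=> y x z; apply: ltn_trans. Qed.

Lemma before_irr s x : before s x x = false.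
Proof. exact: ltnn. Qed.

Lemma before_neqNge s x y :
  vertex_order s -> before s x y = (x != y) && ~~ before s y x.
Proof.
case=> _ ins; have [->|nxy] := eqVneq x y; first exact: before_irr.
rewrite /before -leqNgt ltn_neqAle; case: eqP => // exy.
by case/eqP: nxy; rewrite -(nth_index x (ins x)) exy nth_index.
Qed.

Lemma before_filter (p : pred T) s x y :
  p x -> p y -> before s x y -> before (filter p s) x y.
Proof.
rewrite /before => px py; elim: s => //= a s IH.
case: (eqVneq a x) => [->|nax]; case: (eqVneq _ y) => [eay|nay] //=.
  by rewrite px /= eqxx (negPf nay).
rewrite ltnS => /IH; case: ifP => //= _.
by rewrite (negPf nax) (negPf nay).
Qed.

Lemma before_catl s1 s2 x y : x \in s1 -> before s1 x y -> before (s1 ++ s2) x y.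
Proof.
rewrite /before !index_cat => -> lt; case: ifP => // _.
(* Here [y] lies outside [s1], so its index in the concatenation is at least [size s1]. *)
by apply: leq_trans lt _; apply: leq_trans (index_size _ _) (leq_addr _ _).
Qed.

Lemma before_cat s1 s2 x y :
  x \in s1 -> y \notin s1 -> before (s1 ++ s2) x y.
Proof.
move=> xs1 ys1; apply: before_catl => //.
by rewrite /before (memNindex ys1) index_mem.
Qed.

Lemma before_catr s1 s2 x y :
  x \notin s1 -> y \notin s1 -> before s2 x y -> before (s1 ++ s2) x y.
Proof. by rewrite /before !index_cat => /negPf-> /negPf->; rewrite ltn_add2l. Qed.

(** Positions strictly increase along arcs, so a closed walk from [x] would put [x] before
    itself. *)
Lemma topological_acyclic E s : topological E s -> acyclic E.
Proof.
move=> topE [[//|x p] _ /= cyc].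
have sub : subrel (arc_rel E) (before s) by move=> a b; apply: topE.
have /allP := order_path_min (before_trans (s := s)) (sub_path sub cyc).
by move/(_ x); rewrite mem_rcons mem_head before_irr => /(_ isT).
Qed.

Lemma topological_listing_filter E s (A : {set T}) :
  topological_order E s -> topological_listing E A [seq x <- s | x \in A].
Proof.
case=> -[us ins] topE; split; first exact: filter_uniq.
  by move=> x; rewrite mem_filter ins andbT.
by move=> x y xA yA /topE; apply: before_filter.
Qed.

(** Common form of the two moves: with [i] the index of [t] once [l] is removed, [k = i.+1] gives
    [move_just_after] and [k = i] gives [move_just_before]. *)
Definition insert_at l k s : seq T :=
  let s0 := [seq x <- s | x \notin l] in take k s0 ++ l ++ drop k s0.

Lemma before_insert l k s x y :
  x \notin l -> y \notin l -> before s x y -> before (insert_at l k s) x y.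
Proof.
move=> xl yl lt_xy; rewrite /insert_at; set s0 := filter _ s.
have: before s0 x y by apply: before_filter.
rewrite -{1}(cat_take_drop k s0).
have [xk|xk] := boolP (x \in take k s0); have [yk|yk] := boolP (y \in take k s0).
- rewrite /before !index_cat xk yk => lt; exact: lt.
- by move=> _; apply: before_cat.
(* Impossible case: [y] in the prefix and [x] beyond it contradicts [x] before [y]. *)
- rewrite /before !index_cat (negPf xk) yk => lt; have := index_size y (take k s0).
  by move=> /(leq_trans lt); rewrite ltnNge leq_addr.
rewrite /before !index_cat (negPf xk) (negPf yk) (negPf xl) (negPf yl).
by rewrite !ltn_add2l.
Qed.

(* To be applied with [E'] the graph sorted by [s] plus an arc violating [s]. *)
Lemma insert_topological_order E' l k s :
  vertex_order s -> uniq l ->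
  (forall x y, (x, y) \in E' ->
     let s0 := [seq x <- s | x \notin l] in
     if x \in l then if y \in l then before l x y else k <= index y s0
     else if y \in l then index x s0 < k else before s x y) ->
  topological_order E' (insert_at l k s).
Proof.
move=> [us ins] ul ordE'; pose s0 := [seq x <- s | x \notin l].
have ins0 x : (x \in s0) = (x \notin l) by rewrite mem_filter ins andbT.
have taken x : x \in l -> x \notin take k s0.
  by move=> xl; apply: contraL xl => /mem_take; rewrite ins0.
split; first split.
- have /perm_uniq-> : perm_eq (insert_at l k s) (s0 ++ l).
    by rewrite /insert_at perm_catCA perm_catC cat_take_drop.
  rewrite cat_uniq filter_uniq // ul andbT; apply/hasPn => x /=.
  by rewrite ins0 => ->.
- move=> x; rewrite /insert_at -/s0 !mem_cat orbCA -mem_cat cat_take_drop ins0.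
  by case: (x \in l).
move=> x y /ordE' /=; rewrite -/s0.
case: (boolP (x \in l)) => xl; case: (boolP (y \in l)) => yl.
- move=> lt; apply: before_catr; try exact: taken.
  exact: before_catl.
- move=> ky; apply: before_catr; first exact: taken.
    by rewrite in_take ?ins0 // -leqNgt.
  exact: before_cat.
- by move=> xk; apply: before_cat; [rewrite in_take ?ins0 | apply: taken].
exact: before_insert.
Qed.

End Orders.

(** * Termination of the search *)

Section Search.

Variables (T : finType) (E : {set T * T}) (s : seq T).
Implicit Types (st : state T) (a b : T * T).

Lemma connect_arc a : a \in E -> connect (arc_rel E) a.1 a.2.
Proof. by case: a => x y xyE; apply: connect1. Qed.

(* Each step traverses an arc of [A_F], and visiting [x] only moves the arcs out
   of [x] from the second term to the first. *)
Definition potential st : nat :=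
  #|fwd_arcs st| + #|[set a in E | a.1 \notin fwd st]|.

Lemma visit_fwd_potential x st : potential (visit_fwd E x st) <= potential st.
Proof.
rewrite /visit_fwd; case: ifP => // xF; rewrite /potential /=.
apply: (@leq_trans (#|fwd_arcs st| + #|arcs_out E x|
                    + #|[set a in E | a.1 \notin x |: fwd st]|)).
  by rewrite leq_add2r cardsU leq_subr.
(* The arcs out of [x] and those with source outside [x |: fwd st] are disjoint, so their cardinals
   add up to that of a union inside the old second set. *)
rewrite -addnA leq_add2l -cardsUI.
have -> : arcs_out E x :&: [set a in E | a.1 \notin x |: fwd st] = set0.
  by apply/setP=> a; rewrite !inE negb_or; case: (a.1 == x); rewrite !andbF.
rewrite cards0 addn0.
apply/subset_leq_card/subsetP => a; rewrite !inE negb_or.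
by case/orP=> /andP[-> /=]; [move/eqP->; rewrite xF | case/andP].
Qed.

Lemma search_step_potential st st1 :
  search_step E s st st1 -> potential st1 < potential st.
Proof.
case=> a b /and3P[aF _ _] _ _.
have visit_bwdE y st2 : potential (visit_bwd E y st2) = potential st2.
  by rewrite /visit_bwd; case: ifP.
rewrite visit_bwdE; apply: leq_ltn_trans (visit_fwd_potential _ _) _.
by rewrite /potential /= [X in _ < X + _](cardsD1 a) aF.
Qed.

Lemma search_step_terminates st : Acc (fun st' st => search_step E s st st') st.
Proof.
move: {2}(potential st).+1 (ltnSn (potential st)) => n.
elim: n st => [//|n IH] st ltn.
apply: Acc_intro => st1 /search_step_potential lt; apply: IH.
exact: leq_trans lt ltn.
Qed.

Lemma search_returns st : exists r st', search E s st r st'.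
Proof.
elim: (search_step_terminates st) => {}st _ IH.
have [/existsP[a /existsP[b el]]|none] :=
    boolP [exists a, exists b, eligible s st a b].
  have [mb|mb] := boolP (meets_bwd st a).
    by exists (Some a), (drop_pair st a b); apply: SearchFwd.
  have [mf|mf] := boolP (meets_fwd st a b).
    by exists (Some b), (drop_pair st a b); apply: SearchBwd.
  have step := SearchStep E el mb mf.
  by have [r [st' run]] := IH _ step; exists r, st'; apply: SearchNext run.
exists None, st; apply: SearchNull => a b; apply: contra none => el.
by apply/existsP; exists a; apply/existsP; exists b.
Qed.

(** * The search invariant and the meaning of a returned arc *)

Record search_invariant (v w : T) st : Prop := SearchInvariant {
  inv_w : w \in fwd st;
  inv_v : v \in bwd st;
  inv_disjoint : forall x, x \in fwd st -> x \notin bwd st;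
  inv_reach_fwd : forall x, x \in fwd st -> connect (arc_rel E) w x;
  inv_reach_bwd : forall y, y \in bwd st -> connect (arc_rel E) y v;
  inv_fwd_arcs : forall a, a \in fwd_arcs st -> (a \in E) && (a.1 \in fwd st);
  inv_bwd_arcs : forall b, b \in bwd_arcs st -> (b \in E) && (b.2 \in bwd st);
  inv_fwd_closed : forall a, a \in E -> a.1 \in fwd st ->
    (a \in fwd_arcs st) || (a.2 \in fwd st);
  inv_bwd_closed : forall b, b \in E -> b.2 \in bwd st ->
    (b \in bwd_arcs st) || (b.1 \in bwd st)
}.

Lemma initial_invariant v w : v != w -> search_invariant v w (initial E v w).
Proof.
move=> vw; split=> /= [||x|x|y|a|b|a|b]; rewrite ?inE //.
- by move/eqP->; rewrite eq_sym.
- by move/eqP->.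
- by move/eqP->.
- by move=> -> ->.
by move=> -> ->.
Qed.

Lemma step_invariant v w st st1 :
  search_step E s st st1 -> search_invariant v w st -> search_invariant v w st1.
Proof.
case=> a b /and3P[aA bA _] aB bF [wF vB dis rF rB aF_ bB_ cF cB].
have setU1_id (A : {set T}) x : x \in A -> x |: A = A.
  by rewrite -sub1set => /setUidPr.
have fwd_visitE x st2 : fwd (visit_fwd E x st2) = x |: fwd st2.
  by rewrite /visit_fwd; case: ifP => //= xF; rewrite setU1_id.
set st2 := visit_bwd _ _ _.
have fwdE : fwd st2 = a.2 |: fwd st.
  by rewrite /st2 /visit_bwd; case: ifP => _ /=; rewrite fwd_visitE.
have bwdE : bwd st2 = b.1 |: bwd st.
  rewrite /st2 /visit_bwd /visit_fwd.
  by case: (a.2 \in _) => /=; case: ifP => //= bB; rewrite setU1_id.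
have fwd_arcsE c : (c \in fwd_arcs st2) =
    (c != a) && (c \in fwd_arcs st)
    || [&& a.2 \notin fwd st, c \in E & c.1 == a.2].
  rewrite /st2 /visit_bwd /visit_fwd /=.
  by case: (a.2 \in _) => /=; case: (b.1 \in _); rewrite /= !inE ?orbF.
have bwd_arcsE c : (c \in bwd_arcs st2) =
    (c != b) && (c \in bwd_arcs st)
    || [&& b.1 \notin bwd st, c \in E & c.2 == b.1].
  rewrite /st2 /visit_bwd /visit_fwd /=.
  by case: (a.2 \in _) => /=; case: (b.1 \in _); rewrite /= !inE ?orbF.
have /andP[aE a1F] := aF_ _ aA; have /andP[bE b2B] := bB_ _ bA.
split; rewrite ?fwdE ?bwdE ?setU1r //.
- move=> x; rewrite !inE negb_or => xF; apply/andP; split.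
    (* The failed test against [a.2 |: fwd st] also excludes [a.2 = b.1], a vertex that would
       otherwise enter both sets. *)
    by apply: contraNneq bF => ex; rewrite /meets_fwd -ex !inE.
  by case/predU1P: xF => [->|/dis].
- move=> x /setU1P[->|/rF//]; apply: connect_trans (rF _ a1F) _.
  exact: connect_arc.
- move=> x /setU1P[->|/rB//]; apply: connect_trans (rB _ b2B).
  exact: connect_arc.
- move=> c; rewrite fwd_arcsE => /orP[/andP[_ /aF_/andP[-> cF1]]|].
    by rewrite setU1r.
  by case/and3P=> _ -> /eqP->; rewrite setU11.
- move=> c; rewrite bwd_arcsE => /orP[/andP[_ /bB_/andP[-> cB1]]|].
    by rewrite setU1r.
  by case/and3P=> _ -> /eqP->; rewrite setU11.
- move=> c cE; rewrite fwd_arcsE !inE cE.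
  (* The removed arc [a] is harmless, its head being now in [F]; if [a.2] is new, all its outgoing
     arcs have just been added. *)
  have [->|_] := eqVneq c a; first by rewrite eqxx orbT.
  case: (boolP (c.1 \in fwd st)) => [/(cF _ cE)/orP[]-> _|cF1]; rewrite ?orbT //.
  by rewrite orbF => /eqP<-; rewrite cF1 eqxx !orbT.
move=> c cE; rewrite bwd_arcsE !inE cE.
have [->|_] := eqVneq c b; first by rewrite eqxx orbT.
case: (boolP (c.2 \in bwd st)) => [/(cB _ cE)/orP[]-> _|cB1]; rewrite ?orbT //.
by rewrite orbF => /eqP<-; rewrite cB1 eqxx !orbT.
Qed.

Lemma search_null v w st st' :
  search_invariant v w st -> search E s st None st' ->
  search_invariant v w st' /\ forall a b, ~~ eligible s st' a b.
Proof.
move=> inv run; move Er: None run => r run.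
elim: run inv Er => // [st1 st2 r' st3 step _ IH] inv.
by apply: IH; apply: step_invariant inv.
Qed.

Lemma search_some v w st r st' :
  search_invariant v w st -> search E s st (Some r) st' ->
  connect (arc_rel E) w v.
Proof.
move=> inv run; move Er: (Some r) run => r' run.
elim: run inv Er => {st r' st'} //
  [st a b el mb|st a b el mb mf|st st1 r' st' step _ IH] inv.
- move=> _; have /and3P[/(inv_fwd_arcs inv)/andP[aE aF] _ _] := el.
  apply: connect_trans (inv_reach_fwd inv aF) _.
  exact: connect_trans (connect_arc aE) (inv_reach_bwd inv mb).
- move=> _; have /and3P[/(inv_fwd_arcs inv)/andP[aE aF]] := el.
  move=> /(inv_bwd_arcs inv)/andP[bE bB] _.
  (* If [b.1 = a.2], this vertex may lie outside [F], and is reached through [a]. *)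
  have wb : connect (arc_rel E) w b.1.
    case/setU1P: mf => [->|/(inv_reach_fwd inv)//].
    exact: connect_trans (inv_reach_fwd inv aF) (connect_arc aE).
  apply: connect_trans wb _.
  exact: connect_trans (connect_arc bE) (inv_reach_bwd inv bB).
by apply: IH; apply: step_invariant inv.
Qed.

Lemma connect_has_cycle v w :
  connect (arc_rel E) w v -> has_cycle ((v, w) |: E).
Proof.
case/connectP=> p pathp ev; exists (w :: p) => //=.
rewrite rcons_path -ev /arc_rel /= setU11 andbT.
by apply: sub_path pathp => x y /=; apply: setU1r.
Qed.

(** * Reordering after a null search *)

Lemma reordering_topological v w st s' :
  topological_order E s -> before s w v -> search_invariant v w st ->
  (forall a b, ~~ eligible s st a b) -> reordering E s v st s' ->
  topological_order ((v, w) |: E) s'.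
Proof.
case=> ordS topE lt_wv inv none; rewrite /reordering.
have [us ins] := ordS.
pose t := threshold s v st; rewrite -/t.
have [tD tmin] : t \in v |: [set a.1 | a in fwd_arcs st] /\
    forall u, u \in v |: [set a.1 | a in fwd_arcs st] -> index t s <= index u s.
  by rewrite /t /threshold; case: arg_minnP; rewrite ?setU11.
have fwd_next x y : (x, y) \in E -> x \in fwd_below s t st -> y \in fwd st.
  rewrite inE => xyE /andP[xF xt].
  have /= /orP[xyA|//] := inv_fwd_closed inv xyE xF.
  (* An arc left in [A_F] with source before [t] would contradict the minimality of [t]. *)
  have := tmin x; rewrite leqNgt -/(before s x t) xt => /(_ _)/negP[] //.
  by rewrite setU1r //; apply/imsetP; exists (x, y).
move=> [lF [lB [[uF inF topF] [uB inB topB] ->]]].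
have [tv|tv] := eqVneq t v.
  apply: insert_topological_order => // x y.
  have vF : v \notin fwd_below s t st by rewrite inE tv before_irr andbF.
  have wF : w \in fwd_below s t st by rewrite inE tv (inv_w inv).
  have tl : t \notin fwd_below s t st by rewrite {1}tv.
  case/setU1P=> [[-> ->]|xyE] /=; rewrite !inF.
    by rewrite (negPf vF) wF tv.
  have lt_xy := topE _ _ xyE.
  case: (boolP (x \in _)) => xF; case: (boolP (y \in _)) => yF //.
  - exact: topF.
  - apply: before_filter; rewrite ?inF //.
    (* The block goes after [t], so [y] must lie strictly beyond it: [y] is in [F], not below [t],
       and differs from [t = v], which is in [B]. *)
    rewrite before_neqNge //; move: yF (fwd_next _ _ xyE xF).
    rewrite inE => yF' yF; rewrite yF /= in yF'; rewrite yF' andbT.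
    apply: contraL yF => /eqP<-; apply/negP => /(inv_disjoint inv).
    by rewrite tv (inv_v inv).
  rewrite ltnS; apply/ltnW/before_filter; rewrite ?inF //.
  by apply: before_trans lt_xy _; move: yF; rewrite inE => /andP[].
have /imsetP[a aA ta] : t \in [set a.1 | a in fwd_arcs st].
  by move: tD; rewrite !inE (negPf tv).
have tF : t \in fwd st by rewrite ta; have /andP[] := inv_fwd_arcs inv aA.
have bwd_prev x y : (x, y) \in E -> y \in bwd_above s t st -> x \in bwd st.
  rewrite inE => xyE /andP[yB ty].
  have /= /orP[xyA|//] := inv_bwd_closed inv xyE yB.
  (* Were [(x, y)] still in [A_B], it would be eligible with [a], whose source is [t]. *)
  by have := none a (x, y); rewrite /eligible aA xyA -ta ty.
have inl x : (x \in lB ++ lF) = (x \in fwd_below s t st) || (x \in bwd_above s t st).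
  by rewrite mem_cat inF inB orbC.
have FB x : x \in fwd_below s t st -> x \notin bwd_above s t st.
  by rewrite !inE => /andP[/(inv_disjoint inv)/negPf->].
have tl : t \notin lB ++ lF by rewrite inl !inE before_irr !andbF.
have ul : uniq (lB ++ lF).
  rewrite cat_uniq uB uF andbT; apply/hasPn => x /=; rewrite inF inB; exact: FB.
have ge_t y : y \notin lB ++ lF -> ~~ before s y t ->
    let s0 := [seq x <- s | x \notin lB ++ lF] in index t s0 <= index y s0.
  move=> yl yt /=; have [->//|nty] := eqVneq t y.
  by apply/ltnW/before_filter => //; rewrite before_neqNge // nty.
have fwd_out y : y \in fwd st -> y \notin lB ++ lF -> ~~ before s y t.
  by move=> yF; rewrite inl !inE yF negb_or => /andP[].
have lt_tv : before s t v.
  by rewrite before_neqNge // tv /before -leqNgt tmin // setU11.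
have vB : v \in bwd_above s t st by rewrite inE (inv_v inv).
apply: insert_topological_order => // x y.
case/setU1P=> [[-> ->]|xyE] /=.
  (* For the new arc, [v] is in [lB]; [w] is either in [lF], which follows [lB], or stays at or
     after [t]. *)
  rewrite [v \in _ ++ _]inl vB orbT; case: ifPn => wl.
    have wB := inv_disjoint inv (inv_w inv).
    by apply: before_cat; rewrite inB // inE (negPf wB).
  by apply: ge_t => //; apply: fwd_out => //; apply: inv_w inv.
have lt_xy := topE _ _ xyE.
case: ifPn => xl; case: ifPn => yl //.
- move: xl; rewrite inl => /orP[] xl.
    have yF := fwd_next _ _ xyE xl.
    have yB : y \notin bwd_above s t st by rewrite inE (negPf (inv_disjoint inv yF)).
    have yl' : y \in fwd_below s t st by move: yl; rewrite inl (negPf yB) orbF.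
    by apply: before_catr; rewrite ?inB ?FB //; apply: topF.
  have [yB|yB] := boolP (y \in bwd_above s t st).
    by apply: before_catl; rewrite ?inB //; apply: topB.
  by apply: before_cat; rewrite inB.
- move: xl; rewrite inl => /orP[] xl.
    by apply: ge_t => //; apply: fwd_out => //; apply: fwd_next xyE xl.
  apply: ge_t => //; move: xl; rewrite inE => /andP[_ tx].
  by rewrite /before -leqNgt; apply/ltnW/(before_trans tx).
apply: before_filter => //; move: yl; rewrite inl => /orP[] yl.
  by apply: before_trans lt_xy _; move: yl; rewrite inE => /andP[].
have xB := bwd_prev _ _ xyE yl.
(* As [x] is in [B] but unmoved, it is not after [t]; it is not [t] either, since [t] is in [F]. *)
rewrite before_neqNge //; apply/andP; split.
  by apply: contraL tF => /eqP<-; apply: contraL xB; apply: inv_disjoint inv _.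
by move: xl; rewrite inl !inE xB negb_or => /andP[].
Qed.

End Search.

Theorem theorem3p1 (T : finType) (E : {set T * T}) (s : seq T) (v w : T)
    (acyclicE : acyclic E) (topE : topological_order E s)
    (lt_wv : before s w v) :
  [/\ (* every run of the search terminates, and returns *)
      Acc (fun st' st => search_step E s st st') (initial E v w)
        /\ (exists r st, compatible_search E s v w r st),
      (* whatever the choices, the result is non-null iff a cycle is created *)
      forall r st, compatible_search E s v w r st ->
        (r <> None <-> has_cycle ((v, w) |: E))
    & (* if it is null, every reordering is a topological order *)
      forall st, compatible_search E s v w None st ->
        (exists s', reordering E s v st s')
        /\ (forall s', reordering E s v st s' ->
              topological_order ((v, w) |: E) s')].
Proof.
have vw : v != w by apply: contraTneq lt_wv => ->; rewrite before_irr.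
have inv0 := initial_invariant E vw.
(* Listing both sets in the old order gives a legal reordering; its result also certifies acyclicity
   in the null case. *)
have reorder st : exists s', reordering E s v st s'.
  eexists; exists [seq x <- s | x \in fwd_below s (threshold s v st) st].
  exists [seq x <- s | x \in bwd_above s (threshold s v st) st].
  by split; [apply: topological_listing_filter.. |].
have null_topological st s' : compatible_search E s v w None st ->
    reordering E s v st s' -> topological_order ((v, w) |: E) s'.
  move=> /(search_null inv0)[inv none]; exact: reordering_topological inv none.
split.
- by split; [apply: search_step_terminates | apply: search_returns].
- case=> [r|] st run; split=> //.
    by move=> _; apply: connect_has_cycle; apply: search_some inv0 run.
  have [s' re] := reorder st; have [_ top] := null_topological _ _ run re.
  by move=> /(topological_acyclic top).
by move=> st run; split=> // s'; apply: null_topological.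
Qed.
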